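(* Let $(M,\omega)$ be a symplectic manifold endowed with a bi-Lagrangian structure. Let $\mathcal{B}_l(M)$ be the set of bi-Lagrangian structures $(\mathcal{F}_1,\mathcal{F}_2)$ on $(M,\omega)$, and let $\mathcal{B}_{lp}(M)\subseteq\mathcal{B}_l(M)$ be the subset of affine ones. The map $$\triangleright:\ Symp(M,\omega)\times\mathcal{B}_l(M)\longrightarrow\mathcal{B}_l(M),\qquad (\psi,(\mathcal{F}_1,\mathcal{F}_2))\longmapsto(\psi_*\mathcal{F}_1,\psi_*\mathcal{F}_2)$$ is a left group action. Moreover, for every $(\psi,(\mathcal{F}_1,\mathcal{F}_2))\in Symp(M,\omega)\times\mathcal{B}_l(M)$, the Hess connection of $(\psi_*\mathcal{F}_1,\psi_*\mathcal{F}_2)$ is $\nabla^{\psi}$, where $\nabla$ is the Hess connection of $(\mathcal{F}_1,\mathcal{F}_2)$, and the inclusion $$\triangleright\bigl(Symp(M,\omega)\times\mathcal{B}_{lp}(M)\bigr)\subset\mathcal{B}_{lp}(M)$$ holds.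
   Context: All objects are smooth. For a foliation $\mathcal{F}$, $\Gamma(\mathcal{F})$ denotes the set of sections of its tangent bundle $T\mathcal{F}$. A foliation $\mathcal{F}$ of a symplectic manifold $(M,\omega)$ is Lagrangian if $\Gamma(\mathcal{F})$ equals its $\omega$-orthogonal $\{Y\in\mathfrak{X}(M):\omega(X,Y)=0\ \text{for all } X\in\Gamma(\mathcal{F})\}$. A bi-Lagrangian structure on $(M,\omega)$ is a pair $(\mathcal{F}_1,\mathcal{F}_2)$ of transversal Lagrangian foliations, so $TM=T\mathcal{F}_1\oplus T\mathcal{F}_2$. Its Hess connection is the unique torsion-free linear connection $\nabla$ on $M$ that parallelizes $\omega$ ($\nabla\omega=0$) and preserves both foliations ($\nabla_XY\in\Gamma(\mathcal{F}_i)$ for all $X\in\mathfrak{X}(M)$, $Y\in\Gamma(\mathcal{F}_i)$, $i=1,2$). The structure is affine if its Hess connection is flat (zero curvature). $Symp(M,\omega)$ is the group of diffeomorphisms $\psi$ of $M$ with $\psi^*\omega=\omega$. The push forward $\psi_*\mathcal{F}$ is the foliation whose leaves are the images under $\psi$ of the leaves of $\mathcal{F}$, so $\Gamma(\psi_*\mathcal{F})=\{\psi_*X: X\in\Gamma(\mathcal{F})\}$. For a linear connection $\nabla$ and a diffeomorphism $\psi$, the connection $\nabla^{\psi}$ is defined by $(\nabla^{\psi})_XY=\psi_*\bigl(\nabla_{\psi_*^{-1}X}\,\psi_*^{-1}Y\bigr)$. *)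

(* Defs.v *)
From HB Require Import structures.
From mathcomp Require Import all_boot all_order all_algebra.
From mathcomp Require Import boolp classical_sets functions cardinality reals.
From mathcomp Require Import topology normedtype landau derive.
From mathcomp Require Import ring.
Set Implicit Arguments.
Unset Strict Implicit.
Unset Printing Implicit Defensive.
Import Order.TTheory GRing.Theory Num.Theory numFieldNormedType.Exports.
Local Open Scope classical_set_scope.
Local Open Scope ring_scope.

Section EuclideanCalculus.
Context {R : realType}.

(* Real functions of class C^k on an open set U of R^n. A function is of class
   C^(k+1) when it is Frechet differentiable on U and all its directional
   derivatives are of class C^k; the values outside U are irrelevant. *)
Fixpoint Ck (k n : nat) (U : set 'rV[R]_n) (f : 'rV[R]_n -> R) : Prop :=
  if k is k'.+1 then
    (forall x, U x -> differentiable f x) /\ (forall v, Ck k' U ('D_v f))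
  else forall x, U x -> {for x, continuous f}.

Definition smooth_on n (U : set 'rV[R]_n) (f : 'rV[R]_n -> R) :=
  forall k, Ck k U f.

Definition smooth_map_on n m (U : set 'rV[R]_n) (h : 'rV[R]_n -> 'rV[R]_m) :=
  forall j, smooth_on U (fun x => h x 0 j).

Lemma Ck_sub k n (U V : set 'rV[R]_n) f : V `<=` U -> Ck k U f -> Ck k V f.
Proof.
move=> VU; elim: k f => [|k IH] f /=; first by move=> H x /VU /H.
by move=> [H1 H2]; split=> [x /VU /H1|v]; last exact: IH.
Qed.

Lemma differentiable_near0 (V : normedModType R) (e : V -> R) (x : V) :
  (\forall y \near x, e y = 0) -> differentiable e x.
Proof.
move=> e0; have ex0 : e x = 0 by exact: nbhs_singleton e0.
have eo : e \o shift x = cst (e x) + \0 +o_ 0 id.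
  apply/eqaddoP => eps eps0; rewrite ex0 !addr0 subr0.
  have := e0; rewrite (near_shift 0) => e0'.
  near=> y => /=.
  have -> : e (y + x) = 0 by near: y; apply: filterS e0' => y /=; rewrite subr0.
  by rewrite normr0 mulr_ge0 ?(ltW eps0).
have c0 : continuous (0 : V -> R) by exact: cst_continuous.
apply/diff_locallyP; have -> : 'd e x = 0 :> (_ -> _) by exact: diff_unique.
by split.
Unshelve. all: by end_near. Qed.

Lemma differentiable_near (V : normedModType R) (f g : V -> R) (x : V) :
  (\forall y \near x, f y = g y) -> differentiable f x -> differentiable g x.
Proof.
move=> fg df; have -> : g = f + (g - f) by rewrite addrC subrK.
apply: differentiableD => //; apply: differentiable_near0.
move: fg. apply: filterS => y fgy.
by rewrite -[LHS]/(g y - f y) fgy subrr.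
Qed.

Lemma near_in_open (T : topologicalType) (U : set T) (P : T -> Prop) x :
  open U -> (forall y, U y -> P y) -> U x -> \forall y \near x, P y.
Proof.
by move=> oU UP Ux; apply: filterS UP _; exact: open_nbhs_nbhs.
Qed.

Lemma Ck_eq k n (U : set 'rV[R]_n) f g : open U ->
  (forall x, U x -> f x = g x) -> Ck k U f -> Ck k U g.
Proof.
move=> oU; elim: k f g => [|k IH] f g fg /=.
  move=> Hf x Ux; rewrite /prop_for /continuous_at -(fg x Ux).
  apply: cvg_trans (Hf x Ux).
  have gf : {near nbhs x, f =1 g}.
    by apply: (near_in_open oU _ Ux) => y Uy; exact: fg.
  exact: near_eq_cvg gf.
have nfg x : U x -> \forall y \near x, f y = g y.
  exact: near_in_open oU fg.
move=> [H1 H2]; split=> [x Ux|v].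
  by apply: differentiable_near (H1 x Ux); exact: nfg.
by apply: IH (H2 v) => x Ux; apply: near_eq_derive; exact: nfg.
Qed.

Lemma CkW k n (U : set 'rV[R]_n) f : Ck k.+1 U f -> Ck k U f.
Proof.
elim: k f => [|k IH] f /=.
  by move=> [H _] x Ux; apply: differentiable_continuous; exact: H.
by move=> [H1 H2]; split=> // v; apply: IH; exact: H2.
Qed.

Lemma Ck_cst k n (U : set 'rV[R]_n) c : Ck k U (cst c).
Proof.
elim: k c => [|k IH] c /=; first by move=> x _; exact: cst_continuous.
split=> [x _|v]; first exact: differentiable_cst.
by have -> : 'D_v (cst c) = cst 0 :> ('rV[R]_n -> R)
  by apply/funext => x; exact: derive_cst.
Qed.

Lemma CkD k n (U : set 'rV[R]_n) f g : open U ->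
  Ck k U f -> Ck k U g -> Ck k U (f + g).
Proof.
move=> oU; elim: k f g => [|k IH] f g /=.
  by move=> Hf Hg x Ux; exact: (continuousD (Hf x Ux) (Hg x Ux)).
move=> [f1 f2] [g1 g2]; split=> [x Ux|v].
  by apply: differentiableD; [exact: f1|exact: g1].
apply: (@Ck_eq _ _ _ ('D_v f + 'D_v g)) => //; last by apply: IH; [exact: f2|exact: g2].
by move=> x Ux; rewrite deriveD//; apply: diff_derivable; [exact: f1|exact: g1].
Qed.

Lemma CkS k n (U : set 'rV[R]_n) f : Ck k.+1 U f <->
  (forall x, U x -> differentiable f x) /\ (forall v, Ck k U ('D_v f)).
Proof. by []. Qed.

Lemma CkM k n (U : set 'rV[R]_n) f g : open U ->
  Ck k U f -> Ck k U g -> Ck k U (f * g).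
Proof.
move=> oU; elim: k f g => [|k IH] f g.
  by move=> Hf Hg x Ux; exact: (continuousM (Hf x Ux) (Hg x Ux)).
move=> f0 g0; have fk := CkW f0; have gk := CkW g0.
move: f0 g0 => /CkS[f1 f2] /CkS[g1 g2]; split=> [x Ux|v].
  by apply: differentiableM; [exact: f1|exact: g1].
apply: (@Ck_eq _ _ _ (f * 'D_v g + g * 'D_v f)) => //.
  by move=> x Ux; rewrite deriveM//; apply: diff_derivable; [exact: f1|exact: g1].
by apply: CkD => //; apply: IH.
Qed.

Lemma Ck_sum k n (U : set 'rV[R]_n) m (f : 'I_m -> 'rV[R]_n -> R) : open U ->
  (forall j, Ck k U (f j)) -> Ck k U (\sum_j f j).
Proof.
move=> oU Hf; elim/big_ind: _ => //; first exact: Ck_cst.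
by move=> g h; exact: CkD.
Qed.

Lemma differentiable_row n m (f : 'rV[R]_n -> 'rV[R]_m) x :
  (forall j, differentiable (fun y => f y 0 j) x) -> differentiable f x.
Proof.
move=> df; have -> : f = \sum_j (fun y => f y 0 j *: delta_mx 0 j).
  apply/funext => y; rewrite fct_sumE [LHS]row_sum_delta.
  by [].
by apply: differentiable_sum => j; exact: differentiableZl.
Qed.

Lemma Ck_comp k n m (U : set 'rV[R]_n) (V : set 'rV[R]_m)
    (f : 'rV[R]_n -> 'rV[R]_m) (g : 'rV[R]_m -> R) :
  open U -> open V -> (forall x, U x -> V (f x)) ->
  (forall j, Ck k U (fun x => f x 0 j)) -> Ck k V g -> Ck k U (g \o f).
Proof.
move=> oU oV fUV; elim: k g => [|k IH] g Hf Hg.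
  move=> x Ux; apply: continuous_comp; last exact/Hg/fUV.
  move=> A [P fP sPA].
  have H : \forall y \near x, forall j, P 0 j (f y 0 j).
    have Hj j : \forall y \near x, P 0 j (f y 0 j) := Hf j x Ux _ (fP 0 j).
    exact: (@filter_forall _ _ (fun j y => P 0 j (f y 0 j)) (nbhs x) _ Hj).
  apply: (filterS _ H) => y Py; apply: sPA => i j; rewrite ord1; exact: Py.
have df x : U x -> differentiable f x.
  by move=> Ux; apply: differentiable_row => j; case: (Hf j) => H _; exact: H.
have fk j := CkW (Hf j).
have g' := CkW Hg; move: Hg => /CkS[g1 g2]; split=> [x Ux|v].
  by apply: differentiable_comp; [exact: df|exact/g1/fUV].
apply: (@Ck_eq _ _ _
   (\sum_j ('D_v (fun x => f x 0 j) * ('D_(delta_mx 0 j) g \o f)))) => //.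
  move=> x Ux; have dfx := df _ Ux; have dgx := g1 _ (fUV _ Ux).
  rewrite deriveE; last exact: differentiable_comp.
  rewrite diff_comp//= fct_sumE [X in 'd g (f x) X](row_sum_delta) linear_sum/=.
  apply: eq_bigr => j _; rewrite linearZ/= -deriveE// -deriveE//.
  by rewrite derive_mx ?mxE//; exact: diff_derivable.
apply: Ck_sum => // j; have /CkS[_ fj] := Hf j.
by apply: CkM => //; exact: IH.
Qed.
End EuclideanCalculus.

Section Manifolds.
Variable R : realType.

(* A chart is given by a total map of which only the restriction to dom is
   meaningful; is_chart says that this restriction is a homeomorphism from an
   open subset of T onto an open subset of R^n. *)
Record chart (n : nat) (T : Type) := Chart {
  dom : set T;
  coord :> T -> 'rV[R]_n }.

Definition is_chart n (T : topologicalType) (c : chart n T) :=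
  [/\ open (dom c),
      forall x y, dom c x -> dom c y -> c x = c y -> x = y,
      forall x, dom c x -> {for x, continuous c}
    & forall V, open V -> V `<=` dom c -> open (c @` V)].

(* d \o c^-1 is smooth on c @` (dom c `&` dom d); likewise below, a function
   read in the chart c is a function h with f = h \o c on dom c. *)
Definition smooth_transition n T (c d : chart n T) :=
  exists h : 'rV[R]_n -> 'rV[R]_n,
    smooth_map_on (c @` (dom c `&` dom d)) h /\
    forall x, dom c x -> dom d x -> d x = h (c x).

(* Smooth manifolds without boundary: Hausdorff second countable spaces with a
   maximal smooth atlas. *)
Record manifold (n : nat) := Manifold {
  carrier :> topologicalType;
  manifold_hausdorff : hausdorff_space carrier;
  manifold_second_countable : @second_countable carrier;
  atlas : set (chart n carrier);
  atlas_chart : forall c, atlas c -> is_chart c;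
  atlas_cover : forall x, exists2 c, atlas c & dom c x;
  atlas_transition : forall c d, atlas c -> atlas d -> smooth_transition c d;
  atlas_maximal : forall c, is_chart c ->
    (forall d, atlas d -> smooth_transition c d /\ smooth_transition d c) ->
    atlas c }.

Definition smooth_fun n (M : manifold n) (f : M -> R) :=
  forall p, exists c, [/\ atlas c, dom c p
    & exists h, smooth_on (c @` dom c) h /\ forall x, dom c x -> f x = h (c x)].

Definition smooth_map m n (M : manifold m) (N : manifold n) (f : M -> N) :=
  forall p, exists c d, [/\ atlas c, atlas d, dom c p,
    forall x, dom c x -> dom d (f x)
    & exists h, smooth_map_on (c @` dom c) h /\
        forall x, dom c x -> d (f x) = h (c x)].

Lemma smooth_sub n (U V : set 'rV[R]_n) f :
  V `<=` U -> smooth_on U f -> smooth_on V f.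
Proof. by move=> VU Hf k; exact: Ck_sub VU (Hf k). Qed.

Lemma smooth_comp n m (U : set 'rV[R]_n) (V : set 'rV[R]_m)
    (f : 'rV[R]_n -> 'rV[R]_m) (g : 'rV[R]_m -> R) :
  open U -> open V -> (forall x, U x -> V (f x)) ->
  smooth_map_on U f -> smooth_on V g -> smooth_on U (g \o f).
Proof.
by move=> oU oV UV Hf Hg k; apply: Ck_comp UV _ (Hg k) => // j; exact: Hf.
Qed.

Lemma smooth_map_cont n m (U : set 'rV[R]_n) (f : 'rV[R]_n -> 'rV[R]_m) x :
  smooth_map_on U f -> U x -> {for x, continuous f}.
Proof.
move=> Hf Ux; apply: differentiable_continuous; apply: differentiable_row => j.
by have /CkS[H _] := Hf j 1%N; exact: H.
Qed.

Definition crestrict n T (c : chart n T) (V : set T) := Chart (dom c `&` V) c.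

Lemma atlas_restrict n (M : manifold n) (c : chart n M) V :
  atlas c -> open V -> atlas (crestrict c V).
Proof.
move=> ac oV; have [oc ci cc co] := atlas_chart ac; apply: atlas_maximal.
  split=> /=.
  - exact: openI.
  - by move=> x y [cx _] [cy _]; exact: ci.
  - by move=> x [cx _]; exact: cc.
  - by move=> W oW WV; apply: co => // x /WV[].
move=> d ad; split.
  have [h [sh hE]] := atlas_transition ac ad.
  exists h; split=> [j|x [cx _]]; last exact: hE.
  by apply: smooth_sub (sh j) => _ [x [[? ?] ?] <-]; exists x.
have [h [sh hE]] := atlas_transition ad ac.
exists h; split=> [j|x dx [cx _]]; last exact: hE.
by apply: smooth_sub (sh j) => _ [x [? [? ?]] <-]; exists x.
Qed.

Lemma open_preimage m n (M : manifold m) (N : manifold n) (f : M -> N) c d W :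
  atlas c -> atlas d -> (forall x, dom c x -> dom d (f x)) ->
  (exists h, smooth_map_on (c @` dom c) h /\
        forall x, dom c x -> d (f x) = h (c x)) ->
  open W -> open (dom c `&` f @^-1` W).
Proof.
move=> ac ad cd [h [sh hE]] oW.
have [oc _ cc _] := atlas_chart ac; have [od di _ do_] := atlas_chart ad.
have oWd : open (d @` (W `&` dom d)) by apply: do_; [exact: openI|move=> x []].
rewrite openE => x [/= cx Wfx].
have chx : {for x, continuous (h \o c)}.
  apply: continuous_comp; first exact: cc.
  by apply: (smooth_map_cont sh); exists x.
have nW : nbhs (h (c x)) (d @` (W `&` dom d)).
  apply: open_nbhs_nbhs; split=> //; exists (f x); last exact: hE.
  by split=> //; exact: cd.
have nc : nbhs x (dom c) by apply: open_nbhs_nbhs.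
have nhc : nbhs x ((h \o c) @^-1` (d @` (W `&` dom d))) := chx _ nW.
apply: filterS (filterI nhc nc) => y [[z [Wz dz] zE] cy]; split=> //.
rewrite -[_ y]/(W (f y)); suff <- : z = f y by [].
by apply: di => //; [exact: cd|rewrite zE /= -hE].
Qed.

Lemma smooth_map_in m n (M : manifold m) (N : manifold n) (f : M -> N) p e :
  smooth_map f -> atlas e -> dom e (f p) ->
  exists c, [/\ atlas c, dom c p, forall x, dom c x -> dom e (f x)
    & exists h, smooth_map_on (c @` dom c) h /\
        forall x, dom c x -> e (f x) = h (c x)].
Proof.
move=> sf ae ep; have [c [d [ac ad cp cd H]]] := sf p.
have [oe _ _ _] := atlas_chart ae.
have oV := open_preimage ac ad cd H oe.
have aV := atlas_restrict ac oV; exists (crestrict c (dom c `&` f @^-1` dom e)).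
split=> //=; first by move=> x [_ []].
have [h [sh hE]] := H; have [t [st tE]] := atlas_transition ad ae.
have [_ _ _ co] := atlas_chart aV; have [od _ _ do_] := atlas_chart ad.
exists (t \o h); split; last first.
  by move=> x [cx [_ ex]]; rewrite /= -hE//; apply: tE => //; exact: cd.
move=> j; apply: (@smooth_comp _ _ _ (d @` (dom d `&` dom e)) h
  (fun y => t y 0 j)).
- by have [oV' _ _ _] := atlas_chart aV; exact: co.
- by apply: do_; [exact: openI|move=> x []].
- move=> _ [x [cx [_ ex]] <-]; rewrite -hE//; exists (f x) => //.
  by split=> //; exact: cd.
- by move=> i; apply: smooth_sub (sh i) => _ [x [cx _] <-]; exists x.
- exact: st.
Qed.

Lemma smooth_map_id n (M : manifold n) : smooth_map (@id M).
Proof.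
move=> p; have [c ac cp] := atlas_cover p; exists c, c; split=> //.
have [h [sh hE]] := atlas_transition ac ac.
exists h; split=> [j|x cx]; last exact: hE.
by apply: smooth_sub (sh j) => _ [x cx <-]; exists x.
Qed.

Lemma smooth_map_comp m n q (M : manifold m) (N : manifold n) (Q : manifold q)
    (f : M -> N) (g : N -> Q) :
  smooth_map f -> smooth_map g -> smooth_map (g \o f).
Proof.
move=> sf sg p; have [d [e [ad ae dp de [k [sk kE]]]]] := sg (f p).
have [c [ac cp cd [h [sh hE]]]] := smooth_map_in sf ad dp.
exists c, e; split=> //; first by move=> x cx; exact/de/cd.
exists (k \o h); split; last by move=> x cx; rewrite /= -hE// kE//; exact: cd.
have [oc _ _ co] := atlas_chart ac; have [od _ _ do_] := atlas_chart ad.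
move=> j; apply: (@smooth_comp _ _ _ (d @` dom d) h (fun y => k y 0 j)) => //.
- exact: co.
- exact: do_.
- by move=> _ [x cx <-]; rewrite -hE//; exists (f x) => //; exact: cd.
Qed.

Lemma smooth_fun_comp m n (M : manifold m) (N : manifold n) (f : M -> N) g :
  smooth_map f -> smooth_fun g -> smooth_fun (g \o f).
Proof.
move=> sf sg p; have [d [ad dp [k [sk kE]]]] := sg (f p).
have [c [ac cp cd [h [sh hE]]]] := smooth_map_in sf ad dp.
exists c; split=> //.
exists (k \o h); split; last by move=> x cx; rewrite /= -hE// kE//; exact: cd.
have [oc _ _ co] := atlas_chart ac; have [od _ _ do_] := atlas_chart ad.
apply: (@smooth_comp _ _ _ (d @` dom d)) => //; [exact: co|exact: do_|].
by move=> _ [x cx <-]; rewrite -hE//; exists (f x) => //; exact: cd.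
Qed.

Lemma smooth_fun_in n (M : manifold n) (f g : M -> R) p :
  smooth_fun f -> smooth_fun g -> exists c, [/\ atlas c, dom c p
    & exists h k, [/\ smooth_on (c @` dom c) h, smooth_on (c @` dom c) k
      & forall x, dom c x -> f x = h (c x) /\ g x = k (c x)]].
Proof.
move=> sf sg; have [d [ad dp [k [sk kE]]]] := sg p.
have [e [ae ep [h [sh hE]]]] := sf p.
have [c [ac cp cd [t [st tE]]]] := smooth_map_in (@smooth_map_id _ M) ad dp.
have [oe _ _ eo] := atlas_chart ae.
have aV := atlas_restrict ac oe; exists (crestrict c (dom e)); split=> //.
have [oc _ _ co] := atlas_chart aV; have [od _ _ do_] := atlas_chart ad.
have [s [ss sE]] := atlas_transition ac ae.
exists (h \o s), (k \o t); split.
- apply: (@smooth_comp _ _ _ (e @` dom e)) => //; [exact: co|exact: eo|].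
  by move=> _ [x [cx ex] <-]; rewrite -sE//; exists x.
- apply: (@smooth_comp _ _ _ (d @` dom d)) => //; [exact: co|exact: do_| |].
    by move=> _ [x [cx _] <-]; rewrite -tE//; exists x => //; exact: cd.
  by move=> j; apply: smooth_sub (st j) => _ [x [cx _] <-]; exists x.
- by move=> x [cx ex]; rewrite /= -sE// -tE// hE// kE//; exact: cd.
Qed.

Lemma smooth_fun_cst n (M : manifold n) (a : R) : smooth_fun (cst a : M -> R).
Proof.
move=> p; have [c ac cp] := atlas_cover p; exists c; split=> //.
by exists (cst a); split=> // k; exact: Ck_cst.
Qed.

Lemma smooth_funD n (M : manifold n) (f g : M -> R) :
  smooth_fun f -> smooth_fun g -> smooth_fun (f + g).
Proof.
move=> sf sg p; have [c [ac cp [h [k [sh sk E]]]]] := smooth_fun_in p sf sg.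
have [oc _ _ co] := atlas_chart ac.
exists c; split=> //; exists (h + k); split=> [l|x /E[fE gE]].
  by apply: CkD => //; exact: co.
by rewrite -[LHS]/(f x + g x) fE gE.
Qed.

Lemma smooth_funM n (M : manifold n) (f g : M -> R) :
  smooth_fun f -> smooth_fun g -> smooth_fun (f * g).
Proof.
move=> sf sg p; have [c [ac cp [h [k [sh sk E]]]]] := smooth_fun_in p sf sg.
have [oc _ _ co] := atlas_chart ac.
exists c; split=> //; exists (h * k); split=> [l|x /E[fE gE]].
  by apply: CkM => //; exact: co.
by rewrite -[LHS]/(f x * g x) fE gE.
Qed.

End Manifolds.

Section SmoothFunctions.
Variables (R : realType) (n : nat) (M : manifold R n).

Definition smooth_pred : {pred M -> R} := fun f => `[< smooth_fun f >].

(* The commutative R-algebra of smooth real functions on M. *)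
Record Cinf := MkCinf { Cinf_val :> M -> R; CinfP : Cinf_val \in smooth_pred }.

HB.instance Definition _ := [isSub for Cinf_val].
HB.instance Definition _ := [Choice of Cinf by <:].

Lemma smooth_predE f : (f \in smooth_pred) = `[< smooth_fun f >].
Proof. by []. Qed.

Lemma smooth_subring : subring_closed smooth_pred.
Proof.
split=> [|f g|f g]; rewrite !smooth_predE.
- by apply/asboolP; exact: smooth_fun_cst.
- move=> /asboolP sf /asboolP sg; apply/asboolP.
  have -> : f - g = f + cst (-1) * g.
    by apply/funext => x; rewrite -[LHS]/(f x - g x) -mulN1r.
  by apply: smooth_funD => //; apply: smooth_funM => //; exact: smooth_fun_cst.
- move=> /asboolP sf /asboolP sg; apply/asboolP; exact: smooth_funM.
Qed.

Lemma smooth_submod : subsemimod_closed smooth_pred.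
Proof.
split; first by split=> [|f g]; rewrite !smooth_predE;
  [apply/asboolP; exact: smooth_fun_cst
  |move=> /asboolP sf /asboolP sg; apply/asboolP; exact: smooth_funD].
move=> a f; rewrite !smooth_predE => /asboolP sf; apply/asboolP.
have -> : a *: f = cst a * f by [].
by apply: smooth_funM => //; exact: smooth_fun_cst.
Qed.

HB.instance Definition _ := GRing.SubChoice_isSubComPzRing.Build
  (M -> R) smooth_pred Cinf smooth_subring.
HB.instance Definition _ := GRing.SubZmodule_isSubLmodule.Build
  R (M -> R) smooth_pred Cinf smooth_submod.

Lemma CinfDE (f g : Cinf) x : (f + g) x = f x + g x. Proof. by []. Qed.
Lemma CinfME (f g : Cinf) x : (f * g) x = f x * g x. Proof. by []. Qed.
Lemma CinfZE a (f : Cinf) x : (a *: f) x = a * f x. Proof. by []. Qed.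

Lemma CinfP_ext (f g : Cinf) : (forall x, f x = g x) -> f = g.
Proof. by move=> fg; apply/val_inj/funext. Qed.

Lemma CinfZr a (f g : Cinf) : a *: (f * g) = f * (a *: g).
Proof. by apply: CinfP_ext => x; rewrite !(CinfZE, CinfME) mulrCA. Qed.

End SmoothFunctions.

Section VectorFields.
Variables (R : realType) (n : nat) (M : manifold R n).
Local Notation C := (Cinf M).

(* Vector fields are identified with the derivations of the algebra of smooth
   functions. *)
Record vfield := VField {
  vf :> C -> C;
  vf_linear : linear vf;
  vf_leibniz : forall f g, vf (f * g) = vf f * g + f * vf g }.

Lemma vfieldP (X Y : vfield) : (forall f, X f = Y f) -> X = Y.
Proof.
case: X Y => [X lX mX] [Y lY mY] /= /funext XY; rewrite {}XY in lX mX *.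
by congr VField; exact: Prop_irrelevance.
Qed.

HB.instance Definition _ := gen_eqMixin vfield.
HB.instance Definition _ := gen_choiceMixin vfield.

Fact vf0_linear : linear (fun _ : C => 0 : C).
Proof. by move=> a f g; rewrite scaler0 addr0. Qed.
Fact vf0_leibniz (f g : C) : 0 = 0 * g + f * 0 :> C.
Proof. by rewrite mul0r mulr0 addr0. Qed.
Definition vf0 := VField vf0_linear vf0_leibniz.

Fact vfD_linear (X Y : vfield) : linear (fun f => X f + Y f).
Proof. by move=> a f g; rewrite !vf_linear scalerDr addrACA. Qed.
Fact vfD_leibniz (X Y : vfield) f g :
  X (f * g) + Y (f * g) = (X f + Y f) * g + f * (X g + Y g).
Proof. by rewrite !vf_leibniz mulrDl mulrDr addrACA. Qed.
Definition vfD X Y := VField (vfD_linear X Y) (vfD_leibniz X Y).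

Fact vfZ_linear (h : C) (X : vfield) : linear (fun f => h * X f).
Proof. by move=> a f g; rewrite vf_linear mulrDr -CinfZr. Qed.
Fact vfZ_leibniz (h : C) (X : vfield) f g :
  h * X (f * g) = h * X f * g + f * (h * X g).
Proof. by rewrite vf_leibniz mulrDr mulrA (mulrCA h f). Qed.
Definition vfZ h X := VField (vfZ_linear h X) (vfZ_leibniz h X).

Definition vfN := vfZ (-1).

Lemma vfDA : associative vfD.
Proof. by move=> X Y Z; apply: vfieldP => f /=; rewrite addrA. Qed.
Lemma vfDC : commutative vfD.
Proof. by move=> X Y; apply: vfieldP => f /=; rewrite addrC. Qed.
Lemma vf0D : left_id vf0 vfD.
Proof. by move=> X; apply: vfieldP => f /=; rewrite add0r. Qed.
Lemma vfND : left_inverse vf0 vfN vfD.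
Proof. by move=> X; apply: vfieldP => f /=; rewrite mulN1r addNr. Qed.

HB.instance Definition _ := GRing.isZmodule.Build vfield vfDA vfDC vf0D vfND.

Lemma vfZA (f g : C) X : vfZ f (vfZ g X) = vfZ (f * g) X.
Proof. by apply: vfieldP => h /=; rewrite mulrA. Qed.
Lemma vf1Z : left_id 1 vfZ.
Proof. by move=> X; apply: vfieldP => h /=; rewrite mul1r. Qed.
Lemma vfZDr : right_distributive vfZ +%R.
Proof. by move=> f X Y; apply: vfieldP => h /=; rewrite mulrDr. Qed.
Lemma vfZDl X : {morph vfZ^~ X : f g / f + g}.
Proof. by move=> f g; apply: vfieldP => h /=; rewrite mulrDl. Qed.

HB.instance Definition _ :=
  GRing.Zmodule_isLmodule.Build C vfield vfZA vf1Z vfZDr vfZDl.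

Lemma vf_add (X : vfield) f g : X (f + g) = X f + X g.
Proof. by rewrite -[f]scale1r vf_linear !scale1r. Qed.

Fact lie_linear (X Y : vfield) : linear (fun f => X (Y f) - Y (X f)).
Proof. by move=> a f g; rewrite !vf_linear scalerBr opprD addrACA. Qed.
Fact lie_leibniz (X Y : vfield) f g :
  X (Y (f * g)) - Y (X (f * g)) =
  (X (Y f) - Y (X f)) * g + f * (X (Y g) - Y (X g)).
Proof. by rewrite !(vf_leibniz, vf_add); ring. Qed.
Definition lie X Y := VField (lie_linear X Y) (lie_leibniz X Y).

End VectorFields.

Section Maps.
Variable R : realType.

Record smap m n (M : manifold R m) (N : manifold R n) := SMap {
  smap_fun :> M -> N;
  smap_smooth : smooth_map smap_fun }.

Lemma smapP m n (M : manifold R m) (N : manifold R n) (f g : smap M N) :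
  (forall x, f x = g x) -> f = g.
Proof.
case: f g => [f sf] [g sg] /= /funext fg; rewrite {}fg in sf *.
by congr SMap; exact: Prop_irrelevance.
Qed.

Definition smap_id n (M : manifold R n) := SMap (@smooth_map_id R n M).

Definition smap_comp m n q (M : manifold R m) (N : manifold R n)
    (Q : manifold R q) (g : smap N Q) (f : smap M N) : smap M Q :=
  SMap (smooth_map_comp (smap_smooth f) (smap_smooth g)).

Fact pull_subproof m n (M : manifold R m) (N : manifold R n)
  (f : smap M N) (g : Cinf N) : g \o f \in smooth_pred (M := M).
Proof.
apply/asboolP/smooth_fun_comp; first exact: smap_smooth.
exact/asboolP/CinfP.
Qed.

Definition pull m n (M : manifold R m) (N : manifold R n) (f : smap M N)
  (g : Cinf N) : Cinf M := MkCinf (pull_subproof f g).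

(* The tangent space at p, as the space of derivations at p of the algebra of
   smooth functions. *)
Definition tangent n (M : manifold R n) (p : M) : set (Cinf M -> R) :=
  [set v | scalar v /\ forall f g : Cinf M, v (f * g) = v f * g p + f p * v g].

Definition vf_at n (M : manifold R n) (X : vfield M) (p : M) : Cinf M -> R :=
  fun f => X f p.

Definition differential m n (M : manifold R m) (N : manifold R n)
  (f : smap M N) (v : Cinf M -> R) : Cinf N -> R := fun g => v (pull f g).

Definition immersion m n (M : manifold R m) (N : manifold R n)
    (f : smap M N) :=
  forall q v w, tangent q v -> tangent q w ->
    differential f v = differential f w -> v = w.

End Maps.

Section Diffeomorphisms.
Variables (R : realType) (n : nat) (M : manifold R n).

Record diffeo := Diffeo {
  diffeo_map :> smap M M;
  diffeo_inv : smap M M;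
  diffeoK : cancel diffeo_map diffeo_inv;
  diffeoVK : cancel diffeo_inv diffeo_map }.

Lemma diffeoP (f g : diffeo) : (forall x, f x = g x) -> f = g.
Proof.
move=> fg; have E1 : diffeo_map f = diffeo_map g by exact: smapP.
have E2 : diffeo_inv f = diffeo_inv g.
  by apply: smapP => x; rewrite -[x in LHS](diffeoVK g) -fg diffeoK.
case: f g E1 E2 {fg} => [f f' fK f'K] [g g' gK g'K] /= E1 E2.
rewrite {}E1 {}E2 in fK f'K *.
by congr Diffeo; exact: Prop_irrelevance.
Qed.

HB.instance Definition _ := gen_eqMixin diffeo.
HB.instance Definition _ := gen_choiceMixin diffeo.

Definition diffeo1 := @Diffeo (smap_id M) (smap_id M) (frefl _) (frefl _).
Definition diffeoV (f : diffeo) := Diffeo (diffeoVK f) (diffeoK f).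
Definition diffeoM (g f : diffeo) :=
  @Diffeo (smap_comp g f) (smap_comp (diffeo_inv f) (diffeo_inv g))
    (can_comp (diffeoK g) (diffeoK f)) (can_comp (diffeoVK f) (diffeoVK g)).

Lemma diffeoMA : associative diffeoM.
Proof. by move=> f g h; exact: diffeoP. Qed.
Lemma diffeo1M : left_id diffeo1 diffeoM.
Proof. by move=> f; exact: diffeoP. Qed.
Lemma diffeoM1 : right_id diffeo1 diffeoM.
Proof. by move=> f; exact: diffeoP. Qed.
Lemma diffeoMV : left_inverse diffeo1 diffeoV diffeoM.
Proof. by move=> f; apply: diffeoP => x; exact: diffeoK. Qed.
Lemma diffeoVM : right_inverse diffeo1 diffeoV diffeoM.
Proof. by move=> f; apply: diffeoP => x; exact: diffeoVK. Qed.

(* The group law is (g * f)%g = g \o f. *)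
HB.instance Definition _ :=
  isGroup.Build diffeo diffeoMA diffeo1M diffeoM1 diffeoMV diffeoVM.

Fact push_linear (psi : diffeo) (X : vfield M) :
  linear (fun f => pull (diffeo_inv psi) (X (pull psi f))).
Proof.
move=> a f g; have -> : pull psi (a *: f + g) = a *: pull psi f + pull psi g.
  exact: CinfP_ext.
by rewrite vf_linear; exact: CinfP_ext.
Qed.

Fact push_leibniz (psi : diffeo) (X : vfield M) f g :
  pull (diffeo_inv psi) (X (pull psi (f * g))) =
  pull (diffeo_inv psi) (X (pull psi f)) * g +
  f * pull (diffeo_inv psi) (X (pull psi g)).
Proof.
have -> : pull psi (f * g) = pull psi f * pull psi g by exact: CinfP_ext.
rewrite vf_leibniz; apply: CinfP_ext => x.
rewrite -[LHS]/(X (pull psi f) (diffeo_inv psi x) * g (psi (diffeo_inv psi x)) +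
  f (psi (diffeo_inv psi x)) * X (pull psi g) (diffeo_inv psi x)).
by rewrite diffeoVK.
Qed.

(* (psi_* X) f = X (f \o psi) \o psi^-1 *)
Definition push (psi : diffeo) (X : vfield M) : vfield M :=
  VField (push_linear psi X) (push_leibniz psi X).

Lemma push1 X : push 1%g X = X.
Proof.
apply: vfieldP => f; apply: CinfP_ext => x /=.
by congr (X _ x); exact: CinfP_ext.
Qed.

Lemma pushM (psi phi : diffeo) X : push (psi * phi)%g X = push psi (push phi X).
Proof.
apply: vfieldP => f; apply: CinfP_ext => x /=.
by congr (X _ _); exact: CinfP_ext.
Qed.

End Diffeomorphisms.

Section SymplecticForms.
Variables (R : realType) (n : nat) (M : manifold R n).
Implicit Types (omega : vfield M -> vfield M -> Cinf M).

(* Differential 2-forms are identified with the alternating maps on vector fields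
   that are bilinear over the algebra of smooth functions. *)
Definition two_form omega :=
  [/\ forall Y, scalar (omega^~ Y), forall X, scalar (omega X)
    & forall X, omega X X = 0].

Definition ext_deriv omega (X Y Z : vfield M) : Cinf M :=
  X (omega Y Z) - Y (omega X Z) + Z (omega X Y)
  - omega (lie X Y) Z + omega (lie X Z) Y - omega (lie Y Z) X.

Definition symplectic omega :=
  [/\ two_form omega,
      forall X Y Z, ext_deriv omega X Y Z = 0
    & forall p X, (forall Y, omega X Y p = 0) -> vf_at X p = 0].

Definition pull_form (psi : diffeo M) omega X Y : Cinf M :=
  pull psi (omega (push psi X) (push psi Y)).

Definition symp_pred omega : {pred diffeo M} :=
  fun psi => `[< pull_form psi omega = omega >].

Lemma pull_form1 omega : pull_form 1%g omega = omega.
Proof.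
apply/funext => X; apply/funext => Y; rewrite /pull_form !push1.
exact: CinfP_ext.
Qed.

Lemma pull_formM psi phi omega :
  pull_form (psi * phi)%g omega = pull_form phi (pull_form psi omega).
Proof.
apply/funext => X; apply/funext => Y; rewrite /pull_form !pushM.
exact: CinfP_ext.
Qed.

Lemma symp_group_closed omega : group_closed (symp_pred omega).
Proof.
split; first by apply/asboolP; exact: pull_form1.
move=> psi phi /asboolP psiP /asboolP phiP; apply/asboolP.
by rewrite pull_formM psiP -{1}phiP -pull_formM mulgV pull_form1.
Qed.

Record symp omega := Symp {
  symp_diffeo :> diffeo M;
  sympP : symp_diffeo \in symp_pred omega }.

HB.instance Definition _ omega := [isSub for @symp_diffeo omega].
HB.instance Definition _ omega := [Choice of symp omega by <:].
HB.instance Definition _ omega := SubChoice_isSubGroup.Build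
  (diffeo M) (symp_pred omega) (symp omega) (symp_group_closed omega).

End SymplecticForms.

Section Foliations.
Variables (R : realType) (n : nat) (M : manifold R n).
Implicit Types (F : set (set M)) (L : set M).

(* i identifies N with L, so that L is a connected immersed submanifold. *)
Definition immersed_as k (N : manifold R k) (i : smap N M) L :=
  [/\ connected [set: N], injective i, immersion i & range i = L].

(* The chart c is flat for F: its image is an open box, in which every leaf is a
   countable union of slices where the coordinates of index >= k are constant. *)
Definition flat_chart k F (c : chart R n M) :=
  [/\ atlas c,
      exists a b : 'rV[R]_n,
        c @` dom c = [set x | forall j, a 0 j < x 0 j < b 0 j]
    & forall L, F L -> exists2 S : set 'rV[R]_n, countable S &
        L `&` dom c = [set x | dom c x /\
          exists2 s, S s & forall j : 'I_n, (k <= j)%N -> c x 0 j = s 0 j]].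

(* A foliation is the set of its leaves. *)
Definition foliation_of_dim k F :=
  [/\ forall L, F L -> L !=set0,
      forall L L', F L -> F L' -> L `&` L' !=set0 -> L = L',
      forall p, exists2 L, F L & L p,
      forall L, F L -> exists (N : manifold R k) (i : smap N M), immersed_as i L
    & forall p, exists2 c, flat_chart k F c & dom c p].

Definition foliation F := exists k, foliation_of_dim k F.

(* The fibre at p of TF: the image under the differential of an immersion
   parametrizing the leaf through p. *)
Definition tangent_leaf F (p : M) : set (Cinf M -> R) :=
  [set v | exists L k (N : manifold R k) (i : smap N M) (q : N) w,
     [/\ F L, immersed_as i L, i q = p, tangent q w & v = differential i w]].

Definition Gamma F : set (vfield M) :=
  [set X | forall p, tangent_leaf F p (vf_at X p)].

Definition transversal_foliations F1 F2 := forall p v, tangent p v ->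
  exists! w : (Cinf M -> R) * (Cinf M -> R),
    [/\ tangent_leaf F1 p w.1, tangent_leaf F2 p w.2 & v = w.1 + w.2].

Definition push_foliation (psi : diffeo M) F : set (set M) :=
  [set psi @` L | L in F].

End Foliations.

Section BiLagrangian.
Variables (R : realType) (n : nat) (M : manifold R n).
Variable omega : vfield M -> vfield M -> Cinf M.
Implicit Types (F : set (set M) * set (set M)).
Implicit Types (nabla : vfield M -> vfield M -> vfield M).

Definition lagrangian (E : set (set M)) :=
  Gamma E = [set Y | forall X, Gamma E X -> omega X Y = 0].

Definition bi_lagrangian : set (set (set M) * set (set M)) :=
  [set F | [/\ foliation F.1, foliation F.2, lagrangian F.1, lagrangian F.2
             & transversal_foliations F.1 F.2]].

Definition linear_connection nabla :=
  [/\ forall Y, linear (nabla^~ Y),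
      forall X Y Z, nabla X (Y + Z) = nabla X Y + nabla X Z
    & forall (X : vfield M) (f : Cinf M) Y,
        nabla X (f *: Y) = X f *: Y + f *: nabla X Y].

Definition torsion_free nabla :=
  forall X Y, nabla X Y - nabla Y X = lie X Y.

Definition parallelizes nabla :=
  forall X Y Z : vfield M,
    X (omega Y Z) = omega (nabla X Y) Z + omega Y (nabla X Z).

Definition preserves nabla (E : set (set M)) :=
  forall X Y, Gamma E Y -> Gamma E (nabla X Y).

Definition flat nabla := forall X Y Z,
  nabla X (nabla Y Z) - nabla Y (nabla X Z) - nabla (lie X Y) Z = 0.

(* nabla is the Hess connection of F, that is, the unique connection with the
   listed properties. *)
Definition hess_connection F nabla :=
  unique (fun D => [/\ linear_connection D, torsion_free D, parallelizes D,
                       preserves D F.1 & preserves D F.2]) nabla.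

Definition affine_bi_lagrangian : set (set (set M) * set (set M)) :=
  [set F | bi_lagrangian F /\
           exists2 nabla, hess_connection F nabla & flat nabla].

Definition push_pair (psi : symp omega) F :=
  (push_foliation psi F.1, push_foliation psi F.2).

Definition push_connection (psi : diffeo M) nabla :
    vfield M -> vfield M -> vfield M :=
  fun X Y => push psi (nabla (push psi^-1%g X) (push psi^-1%g Y)).

End BiLagrangian.

Definition left_action (G : groupType) (T : Type) (X : set T)
    (act : G -> T -> T) :=
  [/\ forall g x, X x -> X (act g x),
      forall x, X x -> act 1%g x = x
    & forall g h x, X x -> act (g * h)%g x = act g (act h x)].

(* Main.v *)
(* Transport of structure. Everything is natural under a diffeomorphism; the only
   analytic point is that pushing a foliation forward pushes its flat charts c to
   c \o psi^-1, which lie in the maximal atlas because the coordinate expression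
   of a smooth map, known to be smooth near each point, glues to a map smooth on
   its whole domain. The uniqueness of the Hess connection of the pushed pair
   follows by pulling a competitor back along psi. *)
Require Import Defs.
From mathcomp Require Import all_boot all_order all_algebra.
From mathcomp Require Import boolp classical_sets reals.
From mathcomp Require Import topology normedtype derive.
Set Implicit Arguments.
Unset Strict Implicit.
Unset Printing Implicit Defensive.
Import GRing.Theory numFieldNormedType.Exports.
Local Open Scope classical_set_scope.
Local Open Scope ring_scope.

(** * Coordinate expressions of smooth maps, and charts carried along a diffeomorphism *)

Section SmoothDiffeomorphisms.
Variable R : realType.

(* No openness is needed: [Ck k U f] only constrains [f] at the points of [U]. *)
Lemma Ck_local k n (U : set 'rV[R]_n) f :
  (forall x, U x -> exists2 V, V x & Ck k V f) -> Ck k U f.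
Proof.
elim: k f => [|k IH] f Hf /=.
  by move=> x /Hf[V Vx]; apply.
split=> [x /Hf[V Vx /CkS[df _]]|v]; first exact: df.
by apply: IH => x /Hf[V Vx /CkS[_ dvf]]; exists V.
Qed.

Lemma smooth_map_continuous m n (M : manifold R m) (N : manifold R n)
    (f : M -> N) : smooth_map f -> continuous f.
Proof.
move=> sf; apply/continuousP => W oW; rewrite openE => p Wfp.
have [c [d [ac ad cp cd H]]] := sf p.
apply: (@filterS _ _ _ (dom c `&` f @^-1` W)); first by move=> x [].
by apply: open_nbhs_nbhs; split; [exact: open_preimage cd H oW|].
Qed.

(** [smooth_map_in] gives coordinate expressions only on suitable charts [e] around each point.
    Fixing one [h] pointwise first turns the rest into a local question, settled by [Ck_local]. *)
Lemma smooth_map_chart m n (M : manifold R m) (N : manifold R n) (f : M -> N)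
    (c : chart R m M) (d : chart R n N) :
  smooth_map f -> atlas c -> atlas d ->
  exists h : 'rV[R]_m -> 'rV[R]_n,
    smooth_map_on (c @` (dom c `&` f @^-1` dom d)) h /\
    forall x, dom c x -> dom d (f x) -> d (f x) = h (c x).
Proof.
move=> sf ac ad; have [oc ci cc co] := atlas_chart ac.
pose P y x := dom c x /\ c x = y.
(* Injectivity of [c] on [dom c] makes the chosen preimage irrelevant; outside the image of [dom c]
   the value 0 is arbitrary. *)
pose h y := if pselect (exists x, P y x) is left e then d (f (projT1 (cid e)))
            else 0.
have hE x : dom c x -> h (c x) = d (f x).
  move=> cx; rewrite /h; case: pselect => [e|[]]; last by exists x.
  by case: (cid e) => z [cz czx] /=; rewrite (ci z x).
exists h; split=> [j k|x cx _]; last by rewrite hE.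
apply: Ck_local => _ [p [cp dp] <-].
have [e [ae ep ed [g [sg gE]]]] := smooth_map_in sf ad dp.
have [oe _ _ eo] := atlas_chart ae.
have [t [st tE]] := atlas_transition ac ae.
have oce : open (c @` (dom c `&` dom e)).
  by apply: co; [exact: openI|move=> x []].
exists (c @` (dom c `&` dom e)); first by exists p.
(* On this neighbourhood [h] is the transition [t] from [c] to [e] followed by the expression [g] of
   [f] in [e] and [d]. *)
apply: (@Ck_eq _ _ _ _ ((fun y => g y 0 j) \o t)) => //.
  by move=> _ [x [cx ex] <-] /=; rewrite hE// -tE// gE.
apply: (@Ck_comp _ _ _ _ _ (e @` dom e)) => //; first exact: eo.
- by move=> _ [x [cx ex] <-]; rewrite -tE//; exists x.
- by move=> i; exact: st.
- exact: sg.
Qed.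

(** Preimages commute with intersections and inherit openness from continuity, so images under [psi]
    are best handled in this form. *)
Lemma diffeo_image n (M : manifold R n) (psi : diffeo M) (A : set M) :
  psi @` A = diffeo_inv psi @^-1` A.
Proof.
apply/seteqP; split=> [_ [x Ax <-]|y Ay]; first by rewrite /= diffeoK.
by exists (diffeo_inv psi y) => //; exact: diffeoVK.
Qed.

Definition push_chart n (M : manifold R n) (psi : diffeo M) (c : chart R n M) :=
  Chart (psi @` dom c) (c \o diffeo_inv psi).

Lemma push_chart_image n (M : manifold R n) (psi : diffeo M) (c : chart R n M)
    (A : set M) :
  push_chart psi c @` (psi @` A) = c @` A.
Proof.
apply/seteqP; split=> [_ [_ [x Ax <-] <-]|_ [x Ax <-]] /=.
  by rewrite diffeoK; exists x.
by exists (psi x); [exists x|rewrite /= diffeoK].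
Qed.

(** By maximality of the atlas only transitions matter: towards a chart [d] they are [psi] read in
    [c] and [d], and back they are the inverse of [psi] read in [d] and [c]. *)
Lemma atlas_push_chart n (M : manifold R n) (psi : diffeo M) (c : chart R n M) :
  atlas c -> atlas (push_chart psi c).
Proof.
move=> ac; have [oc ci cc co] := atlas_chart ac.
have psi_open V : open V -> open (psi @^-1` V).
  move: V; apply/continuousP.
  exact: smooth_map_continuous (smap_smooth psi).
have cpsiV : continuous (diffeo_inv psi) :=
  smooth_map_continuous (smap_smooth (diffeo_inv psi)).
apply: atlas_maximal.
  split=> /=.
  - by rewrite diffeo_image; move/continuousP: cpsiV; exact.
  - by move=> _ _ [x cx <-] [y cy <-] /=; rewrite !diffeoK => /(ci _ _ cx cy) ->.
  - move=> _ [x cx <-]; apply: continuous_comp; first exact: cpsiV.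
    by rewrite /= diffeoK; exact: cc.
  - move=> V oV VU.
    (* In this form [push_chart_image] reduces the openness claim to the one for [c]. *)
    have -> : V = psi @` (psi @^-1` V).
      apply/seteqP; split=> [y Vy|_ [x Vx <-]] //.
      by exists (diffeo_inv psi y); rewrite /= diffeoVK.
    rewrite push_chart_image; apply: co; first exact: psi_open.
    by move=> x /VU; rewrite diffeo_image /= diffeoK.
move=> d ad; split.
  have [h [sh hE]] := smooth_map_chart (smap_smooth psi) ac ad.
  exists h; split=> [j|_ [x cx <-] dx /=]; last by rewrite diffeoK; exact: hE.
  apply: smooth_sub (sh j) => _ [_ [[x cx <-] dx] <-] /=.
  by rewrite diffeoK; exists x.
have [h [sh hE]] := smooth_map_chart (smap_smooth (diffeo_inv psi)) ad ac.
exists h; split=> [j|_ /[swap] -[z cz <-] dz /=]; last first.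
  by apply: hE; rewrite //= diffeoK.
apply: smooth_sub (sh j) => _ [x [dx [z cz zE]] <-].
by exists (psi z); rewrite ?zE //; split=> //=; rewrite -zE diffeoK.
Qed.

End SmoothDiffeomorphisms.

(** * Naturality of functions, tangent vectors and vector fields *)

Section PushForward.
Variables (R : realType) (n : nat) (M : manifold R n).
Implicit Types (psi phi : diffeo M) (X Y : vfield M) (E : set (set M)).

Lemma pullD psi (f g : Cinf M) : pull psi (f + g) = pull psi f + pull psi g.
Proof. exact: CinfP_ext. Qed.

Lemma pullM psi (f g : Cinf M) : pull psi (f * g) = pull psi f * pull psi g.
Proof. exact: CinfP_ext. Qed.

Lemma pull0 psi : pull psi (0 : Cinf M) = 0.
Proof. exact: CinfP_ext. Qed.

Lemma pullK psi : cancel (pull psi) (pull psi^-1%g).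
Proof. by move=> f; apply: CinfP_ext => x /=; rewrite diffeoVK. Qed.

Lemma pullVK psi : cancel (pull psi^-1%g) (pull psi).
Proof. by move=> f; apply: CinfP_ext => x /=; rewrite diffeoK. Qed.

Lemma differentialK psi :
  cancel (differential psi) (differential psi^-1%g).
Proof. by move=> v; apply/funext => f; rewrite /differential pullVK. Qed.

Lemma differentialVK psi :
  cancel (differential psi^-1%g) (differential psi).
Proof. by move=> v; apply/funext => f; rewrite /differential pullK. Qed.

Lemma tangent_differential psi p v :
  tangent p v -> tangent (psi p) (differential psi v).
Proof.
move=> [lv dv]; split=> [a f g|f g].
  by rewrite /differential -lv; congr v; exact: CinfP_ext.
by rewrite /differential pullM dv.
Qed.

Lemma pushK psi : cancel (push psi) (push psi^-1%g).
Proof. by move=> X; rewrite -pushM mulVg push1. Qed.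

Lemma pushVK psi : cancel (push psi^-1%g) (push psi).
Proof. by move=> X; rewrite -pushM mulgV push1. Qed.

Lemma pushD psi X Y : push psi (X + Y) = push psi X + push psi Y.
Proof. by apply: vfieldP => f; exact: CinfP_ext. Qed.

Lemma pushZ psi (f : Cinf M) X :
  push psi (f *: X) = pull psi^-1%g f *: push psi X.
Proof. by apply: vfieldP => g; exact: CinfP_ext. Qed.

Lemma push0 psi : push psi 0 = 0.
Proof. by apply: vfieldP => g; exact: CinfP_ext. Qed.

Lemma pushB psi X Y : push psi (X - Y) = push psi X - push psi Y.
Proof.
by apply: (addIr (push psi Y)); rewrite -pushD !subrK.
Qed.

(** Since [pull psi^-1%g] is the push forward of functions, this is the rule that [psi_*(X f)]
    equals [(psi_* X)(psi_* f)]. *)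
Lemma push_pull psi X f :
  push psi X (pull psi^-1%g f) = pull psi^-1%g (X f).
Proof.
rewrite -[LHS]/(pull psi^-1%g (X (pull psi (pull psi^-1%g f)))).
by rewrite pullVK.
Qed.

(** Push forward conjugates a derivation by [pull psi], so the inner pulls cancel in each double
    derivative. *)
Lemma push_lie psi X Y : push psi (lie X Y) = lie (push psi X) (push psi Y).
Proof.
apply: vfieldP => f.
rewrite -[RHS]/(pull psi^-1%g (X (pull psi (pull psi^-1%g (Y (pull psi f)))))
  - pull psi^-1%g (Y (pull psi (pull psi^-1%g (X (pull psi f)))))).
by rewrite !pullVK; exact: CinfP_ext.
Qed.

(** * Push forward of foliations and of their sections *)

Lemma push_foliation1 E : push_foliation 1%g E = E.
Proof.
have im1 L : (1%g : diffeo M) @` L = L by exact: image_id.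
apply/seteqP; split=> [_ [L EL <-]|L EL]; first by rewrite im1.
by exists L => //; exact: im1.
Qed.

Lemma push_foliationM psi phi E :
  push_foliation (psi * phi)%g E = push_foliation psi (push_foliation phi E).
Proof.
have imM L : (psi * phi)%g @` L = psi @` (phi @` L) by rewrite -image_comp.
apply/seteqP; split=> [_ [L EL <-]|_ [_ [L EL <-] <-]].
  by exists (phi @` L); [exists L|rewrite imM].
by exists L => //; exact: imM.
Qed.

Lemma push_foliationK psi :
  cancel (@push_foliation _ _ M psi) (push_foliation psi^-1%g).
Proof. by move=> E; rewrite -push_foliationM mulVg push_foliation1. Qed.

Lemma differential_comp psi k (N : manifold R k) (i : smap N M) v :
  differential (smap_comp psi i) v = differential psi (differential i v).
Proof.
by apply/funext => f; rewrite /differential; congr v; exact: CinfP_ext.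
Qed.

(** The parametrizing manifold is kept; composing with [psi] preserves injectivity of the
    differential because [differential psi] is invertible. *)
Lemma immersed_as_push psi k (N : manifold R k) (i : smap N M) L :
  immersed_as i L -> immersed_as (smap_comp psi i) (psi @` L).
Proof.
move=> [cN inj_i imm_i <-]; split=> //.
- by move=> x y /(can_inj (diffeoK psi)) /inj_i.
- move=> q v w tv tw; rewrite !differential_comp.
  by move=> /(can_inj (differentialK psi)); exact: imm_i tv tw.
- by rewrite image_comp.
Qed.

Lemma tangent_leaf_push psi E p v :
  tangent_leaf E p v ->
  tangent_leaf (push_foliation psi E) (psi p) (differential psi v).
Proof.
move=> [L [k [N [i [q [w [EL iL <- tw ->]]]]]]].
exists (psi @` L), k, N, (smap_comp psi i), q, w; split=> //; first by exists L.
  exact: immersed_as_push.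
by rewrite differential_comp.
Qed.

Lemma Gamma_push psi E X : Gamma E X -> Gamma (push_foliation psi E) (push psi X).
Proof.
(* By conversion, the value of [push psi X] at a point is the differential of [psi] applied to the
   value of [X] at the preimage. *)
move=> EX p; rewrite -[p](diffeoVK psi) -[vf_at _ _]/(differential psi
  (vf_at X (diffeo_inv psi (psi (diffeo_inv psi p))))) diffeoK.
exact: tangent_leaf_push.
Qed.

(** With [Gamma_push] this shows that the sections of the pushed foliation are exactly the pushed
    sections. *)
Lemma Gamma_pushV psi E X :
  Gamma (push_foliation psi E) X -> Gamma E (push psi^-1%g X).
Proof. by move=> /(Gamma_push psi^-1%g); rewrite push_foliationK. Qed.

(** The pushed chart takes on [psi @ L] the values of [c] on [L], so the box and the countable set
    [S] of slices are unchanged. *)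
Lemma flat_chart_push psi k E c :
  flat_chart k E c -> flat_chart k (push_foliation psi E) (push_chart psi c).
Proof.
move=> [ac [a [b cab]] cL]; split; first exact: atlas_push_chart.
  by exists a, b; rewrite push_chart_image.
move=> _ [L EL <-]; have [S cS LS] := cL _ EL; exists S => //.
rewrite diffeo_image [dom _]diffeo_image.
by rewrite -[LHS]/(diffeo_inv psi @^-1` (L `&` dom c)) LS.
Qed.

Lemma foliation_push psi E : foliation E -> foliation (push_foliation psi E).
Proof.
move=> [k [E0 Edisj Ecov Eimm Eflat]]; exists k; split.
- by move=> _ [L /E0[x Lx] <-]; exists (psi x), x.
- move=> _ _ [L EL <-] [L' EL' <-]; rewrite !diffeo_image => -[x [Lx L'x]].
  by rewrite (Edisj L L')//; exists (diffeo_inv psi x).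
- move=> p; have [L EL Lp] := Ecov (diffeo_inv psi p).
  by exists (psi @` L); [exists L|rewrite diffeo_image].
- move=> _ [L EL <-]; have [N [i iL]] := Eimm _ EL.
  by exists N, (smap_comp psi i); exact: immersed_as_push.
- move=> p; have [c fc cp] := Eflat (diffeo_inv psi p).
  exists (push_chart psi c); first exact: flat_chart_push.
  by exists (diffeo_inv psi p) => //; exact: diffeoVK.
Qed.

(** A vector is pulled back, decomposed there, and its two components pushed forward; a competing
    decomposition is pulled back to meet the known uniqueness. *)
Lemma transversal_push psi E1 E2 : transversal_foliations E1 E2 ->
  transversal_foliations (push_foliation psi E1) (push_foliation psi E2).
Proof.
move=> tr p v /(tangent_differential psi^-1%g) /tr[[w1 w2]].
move=> [[/= E1w E2w vw] uniq_w].
exists (differential psi w1, differential psi w2); split=> /=.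
  split.
  - by rewrite -[p](diffeoVK psi); exact: tangent_leaf_push.
  - by rewrite -[p](diffeoVK psi); exact: tangent_leaf_push.
  - by rewrite -[v](differentialVK psi) vw.
move=> [u1 u2] [/= /(tangent_leaf_push psi^-1%g) E1u
  /(tangent_leaf_push psi^-1%g) E2u vu].
move: E1u E2u; rewrite !push_foliationK => E1u E2u.
have [-> ->] : (w1, w2) = (differential psi^-1%g u1, differential psi^-1%g u2).
  by apply: uniq_w; split; rewrite // vu.
by rewrite !differentialVK.
Qed.

End PushForward.

(** * Invariance of the Lagrangian condition, and the group action on pairs *)

Section Symplectomorphisms.
Variables (R : realType) (n : nat) (M : manifold R n).
Variable omega : vfield M -> vfield M -> Cinf M.
Implicit Types (psi : symp omega) (E : set (set M)).
Implicit Types (F : set (set M) * set (set M)).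
Implicit Types (nabla : vfield M -> vfield M -> vfield M).

Lemma symp_push psi X Y :
  omega (push psi X) (push psi Y) = pull ((psi : diffeo M)^-1)%g (omega X Y).
Proof.
have /asboolP/(congr1 (fun form => form X Y)) <- := sympP psi.
by rewrite /pull_form pullK.
Qed.

Lemma lagrangian_push psi E :
  lagrangian omega E -> lagrangian omega (push_foliation psi E).
Proof.
move=> EL; apply/seteqP; split=> [Y /Gamma_pushV|Y /= HY].
  rewrite EL => HY X /Gamma_pushV /HY XY.
  by rewrite -[X](pushVK psi) -[Y](pushVK psi) symp_push XY pull0.
(* It suffices that [Y] pulled back is orthogonal to [Gamma E]; pushing each test field [X] forward
   reduces this to [HY]. *)
rewrite -[Y](pushVK psi); apply: Gamma_push; rewrite EL /= => X EX.
apply: (can_inj (pullK psi^-1%g)); rewrite -symp_push pushVK pull0.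
by apply: HY; exact: Gamma_push.
Qed.

Lemma bi_lagrangian_push psi F :
  bi_lagrangian omega F -> bi_lagrangian omega (push_pair psi F).
Proof.
move=> [fF1 fF2 lF1 lF2 tF]; split; [exact: foliation_push|exact: foliation_push
  |exact: lagrangian_push|exact: lagrangian_push|exact: transversal_push].
Qed.

Lemma push_pair1 F : push_pair (1%g : symp omega) F = F.
Proof. by case: F => E1 E2; rewrite /push_pair !push_foliation1. Qed.

Lemma push_pairM psi (phi : symp omega) F :
  push_pair (psi * phi)%g F = push_pair psi (push_pair phi F).
Proof. by rewrite /push_pair !push_foliationM. Qed.

(** * Transport of connections and of their defining properties *)

Lemma push_connectionVK (psi : diffeo M) nabla :
  push_connection psi (push_connection psi^-1%g nabla) = nabla.
Proof.
apply/funext => X; apply/funext => Y; rewrite /push_connection.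
by rewrite !pushVK.
Qed.

Lemma linear_connection_push (psi : diffeo M) nabla :
  linear_connection nabla -> linear_connection (push_connection psi nabla).
Proof.
rewrite /push_connection => -[nl nD nL]; split.
- move=> Y f X X'; rewrite pushD pushZ nl pushD pushZ.
  by rewrite (pullVK psi^-1%g).
- by move=> X Y Z; rewrite !(pushD, nD).
(* The coefficient [f] is carried back and then forward, hence restored; [push_pull] turns the
   derivative term into [X f]. *)
- move=> X f Y; rewrite !pushZ nL pushD !pushZ.
  by rewrite -push_pull !pushVK (pullVK psi^-1%g).
Qed.

Lemma torsion_free_push (psi : diffeo M) nabla :
  torsion_free nabla -> torsion_free (push_connection psi nabla).
Proof.
by move=> tf X Y; rewrite /push_connection -pushB tf push_lie !pushVK.
Qed.

(** Invariance of [omega] enters through [symp_push]: once all three fields are written as push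
    forwards, both sides are the same function carried along [psi]. *)
Lemma parallelizes_push psi nabla :
  parallelizes omega nabla -> parallelizes omega (push_connection psi nabla).
Proof.
move=> par X Y Z; rewrite -[X](pushVK psi) -[Y](pushVK psi) -[Z](pushVK psi).
set X' := push _ X; set Y' := push _ Y; set Z' := push _ Z.
by rewrite /push_connection !pushK !symp_push -pullD -par push_pull.
Qed.

Lemma preserves_push (psi : diffeo M) nabla E :
  preserves nabla E ->
  preserves (push_connection psi nabla) (push_foliation psi E).
Proof. by move=> pE X Y /Gamma_pushV EY; exact/Gamma_push/pE. Qed.

(** The curvature of the pushed connection is the push forward of the original curvature. *)
Lemma flat_push (psi : diffeo M) nabla :
  flat nabla -> flat (push_connection psi nabla).
Proof.
move=> fl X Y Z; rewrite /push_connection !pushK push_lie -!pushB fl.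
exact: push0.
Qed.

Lemma hess_connection_push psi F nabla : hess_connection omega F nabla ->
  hess_connection omega (push_pair psi F) (push_connection psi nabla).
Proof.
move=> [[lc tf par p1 p2] uniq_nabla]; split.
  split; [exact: linear_connection_push|exact: torsion_free_push
    |exact: parallelizes_push|exact: preserves_push|exact: preserves_push].
(* The competitor [D] is the push forward of its own pull back, so the goal becomes that this pull
   back equals [nabla]. *)
move=> D [Dlc Dtf Dpar D1 D2]; rewrite -[RHS](push_connectionVK psi).
congr push_connection; apply: uniq_nabla; split.
- exact: linear_connection_push.
- exact: torsion_free_push.
(* The inverse is taken among symplectomorphisms, since invariance of [omega] is required. *)
- exact: (@parallelizes_push psi^-1%g).
- by rewrite -[F.1](push_foliationK psi); exact: preserves_push.
- by rewrite -[F.2](push_foliationK psi); exact: preserves_push.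
Qed.

End Symplectomorphisms.

Local Close Scope ring_scope.
Unset Implicit Arguments.

Theorem theorem2p4 (R : realType) (n : nat) (M : manifold R n)
    (omega : vfield M -> vfield M -> Cinf M)
    (homega : symplectic omega)
    (hbl : bi_lagrangian omega !=set0) :
  [/\ left_action (bi_lagrangian omega) (@push_pair R n M omega),
      forall (psi : symp omega) F, bi_lagrangian omega F ->
        forall nabla, hess_connection omega F nabla ->
          hess_connection omega (push_pair psi F) (push_connection psi nabla)
    & [set push_pair psi F
         | psi in [set: symp omega] & F in affine_bi_lagrangian omega]
        `<=` affine_bi_lagrangian omega].
Proof.
split.
- split.
  + exact: bi_lagrangian_push.
  + by move=> F _; exact: push_pair1.
  + by move=> psi phi F _; exact: push_pairM.
- by move=> psi F _ nabla; exact: hess_connection_push.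
- move=> _ [psi _ [F [blF [nabla hF fl]] <-]]; split.
    exact: bi_lagrangian_push.
  exists (push_connection psi nabla); first exact: hess_connection_push.
  exact: flat_push.
Qed.
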